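(* Let $(\Omega,\mathcal{A},P_0)$ be a probability space (with $P_0$ countably additive) and let $L$ be a linear space of real bounded random variables on $(\Omega,\mathcal{A},P_0)$. Let $\mathbb{P}$ be the set of finitely additive probabilities on $\mathcal{A}$ and $\mathbb{P}_0\subset\mathbb{P}$ the subset of countably additive ones. (a) There is $P\in\mathbb{P}$ such that $P\ll P_0$ and $E_P(X)=0$ for all $X\in L$ if and only if $\text{ess sup}(X)\geq 0$ for each $X\in L$. (b) There is $P\in\mathbb{P}$ such that $P\sim P_0$ and $E_P(X)=0$ for all $X\in L$ if and only if there are $Q\in\mathbb{P}_0$ with $Q\sim P_0$ and a constant $c>0$ such that $$c\,E_Q(X)\leq\text{ess sup}(-X)\quad\text{for each }X\in L.$$ Moreover, every $P\in\mathbb{P}$ such that $P\sim P_0$ and $E_P(X)=0$ for all $X\in L$ admits the representation $P=\alpha\,P_1+(1-\alpha)\,Q$, where $\alpha\in[0,1)$, $P_1\in\mathbb{P}$ is pure (unless $\alpha=0$), $Q\in\mathbb{P}_0$ and $Q\sim P_0$.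
   Context: A finitely additive probability on the $\sigma$-field $\mathcal{A}$ is a map $P:\mathcal{A}\to[0,1]$ with $P(\Omega)=1$ and $P(A\cup B)=P(A)+P(B)$ for disjoint $A,B\in\mathcal{A}$. For $P\in\mathbb{P}$ and a bounded $\mathcal{A}$-measurable $X:\Omega\to\mathbb{R}$, $E_P(X)=\int X\,dP$ is the integral with respect to the finitely additive $P$: it is defined in the obvious way on simple functions and extended by uniform limits (every bounded measurable function is a uniform limit of simple functions). For $P\in\mathbb{P}$, $P\ll P_0$ means that $P(A)=0$ whenever $A\in\mathcal{A}$ and $P_0(A)=0$; $P\sim P_0$ means that $P$ and $P_0$ have the same null sets, i.e. for $A\in\mathcal{A}$, $P(A)=0$ if and only if $P_0(A)=0$. The essential supremum is taken with respect to $P_0$: $\text{ess sup}(X)=\inf\{a\in\mathbb{R}:P_0(X>a)=0\}$. $P\in\mathbb{P}$ is called pure if it has no nontrivial $\sigma$-additive part: whenever $\Gamma$ is a $\sigma$-additive measure on $\mathcal{A}$ with $0\leq\Gamma\leq P$, then $\Gamma=0$. *)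

(* Defs.v *)
From HB Require Import structures.
From mathcomp Require Import all_boot all_order all_algebra.
From mathcomp Require Import all_classical all_reals all_analysis.
From mathcomp Require Import measurable_realfun ring lra.
Set Implicit Arguments.
Unset Strict Implicit.
Unset Printing Implicit Defensive.
Import Order.TTheory GRing.Theory Num.Theory.
Import numFieldNormedType.Exports.
Import HBSimple.
Local Open Scope classical_set_scope.
Local Open Scope ring_scope.

Section finitely_additive.
Context d (T : measurableType d) (R : realType).
Local Open Scope ereal_scope.
Implicit Types (P Q : set T -> \bar R) (X : T -> R).

(* Only the values of a content on measurable sets matter in what follows. *)
Definition fa_probability : set {content set T -> \bar R} :=
  [set P | P setT = 1].

(* e is the integral of X with respect to P: a limit of the integrals of simple
   functions converging uniformly to X. Existence of an approximating sequence
   and independence of its choice are sfun_uniform_approx and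
   cvg_fa_expectation below. *)
Definition is_fa_integral P X (e : \bar R) :=
  exists2 s : {sfun T >-> R}^nat,
    {uniform, (fun n => s n : T -> R) @ \oo --> X} &
    (fun n => sintegral P (s n)) @ \oo --> e.

Definition fa_expectation P X : \bar R := get (is_fa_integral P X).

Definition same_null_sets P Q :=
  forall A, measurable A -> P A = 0 <-> Q A = 0.

Definition pure P := forall G : {measure set T -> \bar R},
  (forall A, measurable A -> G A <= P A) ->
  forall A, measurable A -> G A = 0.

End finitely_additive.

Section sintegral_content.
Context d (T : measurableType d) (R : realType) (P : {content set T -> \bar R}).
Hypothesis P1 : P setT = 1%E.

Let p A : R := fine (P A).

Lemma content_fineE A : measurable A -> P A = (p A)%:E.
Proof.
move=> mA; rewrite fineK// ge0_fin_numE//.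
by rewrite (@le_lt_trans _ _ 1%E) ?ltry// -P1 le_measure ?inE.
Qed.

Let p_ge0 A : 0 <= p A. Proof. exact: fine_ge0. Qed.

Let r (f : {sfun T >-> R}) := finmap.enum_fset (fset_set (range f)).

Let pI A (g : {sfun T >-> R}) : measurable A ->
  p A = \sum_(y <- r g) p (A `&` g @^-1` [set y]).
Proof.
move=> mA; have mI y : measurable (A `&` g @^-1` [set y]) by apply: measurableI.
apply: EFin_inj; rewrite -content_fineE// -sumEFin.
under eq_bigr do rewrite -content_fineE//.
rewrite -fsbig_finite//= -content_fin_bigcup//=; last first.
- exact: fin_bigcup_measurable.
- by apply: trivIset_setIl; exact: trivIset_preimage1.
- congr (P _); apply/seteqP; split=> [x Ax|x [y _ []]//].
  by exists (g x).
Qed.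

Lemma sintegral_contentE (f : {sfun T >-> R}) :
  sintegral P f = (\sum_(x <- r f) x * p (f @^-1` [set x]))%:E.
Proof.
rewrite /sintegral -(@fsbig_widen _ _ _ _ (range f))//; last first.
  by move=> x [_ Nfx] /=; rewrite preimage10// measure0 mule0.
rewrite fsbig_finite//=; rewrite -sumEFin; apply: eq_bigr => x _.
by rewrite content_fineE ?EFinM.
Qed.

Lemma sintegral_content_dist (f g : {sfun T >-> R}) (e : R) :
  (forall w, `|f w - g w| <= e) ->
  (`|sintegral P f - sintegral P g| <= e%:E)%E.
Proof.
move=> fge; rewrite !sintegral_contentE -EFinB lee_fin.
have -> : \sum_(x <- r f) x * p (f @^-1` [set x]) =
    \sum_(x <- r f) \sum_(y <- r g) x * p (f @^-1` [set x] `&` g @^-1` [set y]).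
  by apply: eq_bigr => x _; rewrite (pI g)// mulr_sumr.
have -> : \sum_(y <- r g) y * p (g @^-1` [set y]) =
    \sum_(x <- r f) \sum_(y <- r g) y * p (f @^-1` [set x] `&` g @^-1` [set y]).
  rewrite exchange_big/=; apply: eq_bigr => y _; rewrite (pI f)// mulr_sumr.
  by under eq_bigr do rewrite setIC.
rewrite -sumrB.
under eq_bigr do rewrite -sumrB.
have -> : e =
    \sum_(x <- r f) \sum_(y <- r g) e * p (f @^-1` [set x] `&` g @^-1` [set y]).
  under eq_bigr do rewrite -mulr_sumr -pI//.
  rewrite -mulr_sumr; under eq_bigr do rewrite -[_ @^-1` _]setTI.
  by rewrite -pI// /p P1 mulr1.
apply: (le_trans (ler_norm_sum _ _ _)); apply: ler_sum => x _.
apply: (le_trans (ler_norm_sum _ _ _)); apply: ler_sum => y _.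
rewrite -mulrBl normrM (ger0_norm (p_ge0 _)).
have [[w [<- <-]]|n] := pselect (exists w, f w = x /\ g w = y).
  by rewrite ler_wpM2r ?p_ge0.
suff -> : f @^-1` [set x] `&` g @^-1` [set y] = set0.
  by rewrite /p measure0/= !mulr0.
by rewrite -subset0 => w [] fx gy; apply: n; exists w.
Qed.

End sintegral_content.

Section uniform_approximation.
Context d (T : measurableType d) (R : realType).

Lemma sfun_uniform_approx (X : {mfun T >-> R}) : bounded_fun (X : T -> R) ->
  exists s : {sfun T >-> R}^nat,
    {uniform, (fun n => s n : T -> R) @ \oo --> (X : T -> R)}.
Proof.
move=> bX.
have [M XM] : exists M : nat, forall w, `|X w| <= M%:R.
  have [b [_ /(_ (b + 1))]] := bX.
  rewrite ltrDl ltr01 => /(_ isT) Xb.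
  exists (Num.truncn (Num.max 0 (b + 1))).+1 => w.
  apply: (le_trans (Xb w I)); apply/ltW/(le_lt_trans _ (truncnS_gt _)).
  by rewrite le_max lexx orbT.
pose h n w := (X w + M%:R) * n.+1%:R.
pose s n w : R := (Num.truncn (h n w))%:R / n.+1%:R - M%:R.
have h0 n w : 0 <= h n w.
  rewrite mulr_ge0// -[M%:R]opprK subr_ge0.
  by have := XM w; rewrite ler_norml => /andP[].
have mh n : measurable_fun setT (h n).
  by apply: measurable_funM => //; apply: measurable_funD.
have sP n : s n \in sfun.
  rewrite inE; apply/andP; split; rewrite inE/=.
    move=> _ Y mY; rewrite setTI.
    have -> : s n @^-1` Y = \bigcup_(k in
        [set k : nat | Y (k%:R / n.+1%:R - M%:R)])
        (h n @^-1` [set` `[k%:R, k.+1%:R[ ]).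
      apply/seteqP; split=> [w Yw|w [k Yk] /=].
        exists (Num.truncn (h n w)) => //=.
        by rewrite in_itv/= truncn_itv.
      rewrite in_itv/= => /andP[k1 k2]; rewrite /s.
      by have -> : Num.truncn (h n w) = k by apply/eqP; rewrite truncn_eq// k1 k2.
    apply: bigcup_measurable => k _.
    by rewrite -[_ @^-1` _]setTI; apply: mh => //.
  apply: (@sub_finite_set _ _
    ((fun k : nat => k%:R / n.+1%:R - M%:R) @` `I_((2 * M * n.+1).+1))); last first.
    by apply: finite_image; exact: finite_II.
  move=> _ [w _ <-]; exists (Num.truncn (h n w)) => //=.
  rewrite ltnS -(ler_nat R).
  have := truncn_itv (h0 n w) => /andP[+ _] => /le_trans; apply.
  rewrite /h natrM ler_wpM2r// natrM mulr_natl mulr2n lerD2r.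
  by rewrite (le_trans _ (XM w))// ler_norm.
exists (fun n => sfun_Sub (sP n)) => A /uniform_nbhs[E [+ EA]].
rewrite -entourage_ballE => -[e /= e0 eE].
near=> n; apply: EA => w _; apply: eE; rewrite /ball/= /s.
have n0 : (0 : R) < n.+1%:R by rewrite ltr0n.
have /andP[t1 t2] := truncn_itv (h0 n w).
have -> : X w = h n w / n.+1%:R - M%:R by rewrite /h mulfK ?addrK ?gt_eqF.
rewrite opprB addrA subrK -mulrBl ger0_norm ?divr_ge0 ?subr_ge0 ?(ltW n0)//.
apply: (@le_lt_trans _ _ n.+1%:R^-1); last first.
  by near: n; exact: (near_infty_natSinv_lt (PosNum e0)).
by rewrite ler_piMl ?invr_ge0 ?(ltW n0)// lerBlDr addrC natr1 ltW.
Unshelve. all: by end_near. Qed.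

End uniform_approximation.

Section fa_expectation.
Context d (T : measurableType d) (R : realType) (P : {content set T -> \bar R}).
Hypothesis P1 : P setT = 1%E.

Lemma uniform_cvg_near (s : {sfun T >-> R}^nat) (X : T -> R) (e : R) : 0 < e ->
  {uniform, (fun n => s n : T -> R) @ \oo --> X} ->
  \forall n \near \oo, forall w, `|X w - s n w| < e.
Proof.
move=> e0 sX.
have /sX : nbhs (X : {uniform T -> R}) [set h | forall w, `|X w - h w| < e].
  apply/uniform_nbhs; exists [set xy | ball xy.1 e xy.2]; split.
    by rewrite -entourage_ballE; exists e.
  by move=> h /= H w; apply: (H w I).
by [].
Qed.

Lemma sintegral_content_fin_num (f : {sfun T >-> R}) :
  sintegral P f \is a fin_num.
Proof. by rewrite (sintegral_contentE P1). Qed.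

Lemma sintegral_uniform_close (s s' : {sfun T >-> R}^nat) (X : T -> R)
    (e : R) : 0 < e ->
  {uniform, (fun n => s n : T -> R) @ \oo --> X} ->
  {uniform, (fun n => s' n : T -> R) @ \oo --> X} ->
  exists N, forall m n, (N <= m)%N -> (N <= n)%N ->
    `|fine (sintegral P (s m)) - fine (sintegral P (s' n))| <= e.
Proof.
move=> e0 sX s'X.
have e20 : 0 < e / 2 by rewrite divr_gt0.
have [N _ HN] := uniform_cvg_near e20 sX.
have [N' _ HN'] := uniform_cvg_near e20 s'X.
exists (maxn N N') => m n; rewrite !geq_max => /andP[m1 m2] /andP[n1 n2].
rewrite -lee_fin.
rewrite -[(`|_|%:E)%E]/(`|(fine (sintegral P (s m)) - fine (sintegral P (s' n)))%:E|)%E.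
rewrite EFinB !fineK ?sintegral_content_fin_num//.
apply: (sintegral_content_dist P1) => w.
have -> : s m w - s' n w = (X w - s' n w) - (X w - s m w) by ring.
rewrite (le_trans (ler_normB _ _))// [e]splitr lerD// ltW//.
  exact: (HN' n n2).
exact: (HN m m1).
Qed.

Lemma sintegral_uniform_cvg (s : {sfun T >-> R}^nat) (X : T -> R) :
  {uniform, (fun n => s n : T -> R) @ \oo --> X} ->
  exists l : R, forall s' : {sfun T >-> R}^nat,
  {uniform, (fun n => s' n : T -> R) @ \oo --> X} ->
   (fun n => sintegral P (s' n)) @ \oo --> l%:E.
Proof.
move=> sX.
have : cvgn (fun n => fine (sintegral P (s n))).
  apply/cauchy_cvgP/cauchy_exP => e e0.
  have [N HN] := sintegral_uniform_close (divr_gt0 e0 (ltr0n R 2)) sX sX.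
  exists (fine (sintegral P (s N))); exists N => // n /= Nn.
  rewrite /ball/=; apply: (le_lt_trans (HN _ _ _ _)) => //.
  by rewrite ltr_pdivrMr// ltr_pMr// ltr1n.
move=> /cvg_ex[l /= sl]; exists l => s' s'X.
apply/fine_cvgP; split; first by near=> n; exact: sintegral_content_fin_num.
apply/cvgrPdist_le => e e0.
have e20 : 0 < e / 2 by rewrite divr_gt0.
have [N HN] := sintegral_uniform_close e20 sX s'X.
move/cvgrPdist_le : sl => /(_ _ e20) sl.
near=> n.
have -> : l - (fine \o (fun n => sintegral P (s' n))) n =
    (l - fine (sintegral P (s n))) +
    (fine (sintegral P (s n)) - fine (sintegral P (s' n))).
  by rewrite /=; ring.
rewrite (le_trans (ler_normD _ _))// [leRHS]splitr lerD//.
  by near: n.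
by apply: HN; near: n; exists N.
Unshelve. all: by end_near. Qed.

Lemma cvg_fa_expectation (s : {sfun T >-> R}^nat) (X : T -> R) :
  {uniform, (fun n => s n : T -> R) @ \oo --> X} ->
  (fun n => sintegral P (s n)) @ \oo --> fa_expectation P X.
Proof.
move=> sX; have [l Pl] := sintegral_uniform_cvg sX.
suff -> : fa_expectation P X = l%:E by exact: Pl.
apply: get_unique; first by exists s => //; exact: Pl.
move=> e [s' s'X s'e].
by apply: (cvg_unique (@ereal_hausdorff R) s'e); exact: Pl.
Qed.

End fa_expectation.

(* Main.v *)
Require Import Defs.
From HB Require Import structures.
From mathcomp Require Import all_boot all_order all_algebra.
From mathcomp Require Import all_classical all_reals all_analysis.
From mathcomp Require Import ess_sup_inf measurable_realfun ring lra.
Set Implicit Arguments.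
Unset Strict Implicit.
Unset Printing Implicit Defensive.
Import Order.TTheory GRing.Theory Num.Theory.
Import numFieldNormedType.Exports.
Import HBSimple.
Local Open Scope classical_set_scope.
Local Open Scope ring_scope.

(** Both equivalences come from two tools.

    Hahn-Banach. The map X |-> ess sup X is sublinear on the bounded
    measurable functions. If a linear functional f on a subspace F satisfies
    f <= ess sup, it extends to a linear functional phi <= ess sup on all
    bounded measurable functions, and A |-> phi(1_A) is then a finitely
    additive probability, absolutely continuous with respect to P0, whose
    integral is phi ([exists_fa_probability_extension]; that the integral is
    phi is [fa_expectation_unique]). With f = 0 this is the nontrivial half of
    (a); the other half is E_P(X) <= ess sup X for P << P0
    ([fa_expectation_le_ess_sup]). For (b), given Q and c, the inequality at -X
    says that f(X) = - c E_Q(X) is dominated by ess sup on L. The extension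
    yields P' << P0 with E_P' = - c E_Q on L, so (P' + c Q) / (1 + c) has zero
    expectation on L, and it has the null sets of P0 because of its Q-part.

    The largest sigma-additive part. For a finitely additive P, the outer
    measure P^*(A) = inf (sum_k P(F_k)), over countable measurable covers F of
    A, is a measure on the measurable sets, and it is the largest measure below
    P ([exists_sigma_additive_part]). Hence P - P^* is pure up to
    normalisation. If P has the null sets of P0, so does P^*: when P^*(A) = 0
    there are covers of A of arbitrarily small total P-mass; cutting each of
    them to finitely many sets loses little P0-mass, and intersecting the
    resulting finite unions gives a subset B of A that is P-null, hence
    P0-null, while P0(A \ B) is as small as desired
    ([mu_ext_content0_null]). In particular P^*(Omega) > 0, and normalising P^*
    and P - P^* gives the decomposition P = alpha P1 + (1 - alpha) Q with
    alpha < 1 ([yosida_hewitt]). If alpha > 0, then P1 << P0 and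
    (1 - alpha) E_Q(X) = alpha E_P1(-X) on L, so the bound of (b) holds with
    c = (1 - alpha) / alpha. If alpha = 0, then E_Q vanishes on L and c = 1
    will do. *)

(** * Hahn-Banach extension on a subspace *)

Section hahn_banach.
Context (R : realType) (V : lmodType R) (B F : set V) (p f : V -> R).
Hypothesis subB : GRing.submod_closed [in B].
Hypothesis subF : GRing.submod_closed [in F].
Hypothesis FB : F `<=` B.
Hypothesis pD : forall x y, B x -> B y -> p (x + y) <= p x + p y.
Hypothesis pZ : forall k x, 0 < k -> B x -> p (k *: x) = k * p x.
Hypothesis f_lin : forall k x y, F x -> F y -> f (k *: x + y) = k * f x + f y.
Hypothesis f_le : forall x, F x -> f x <= p x.

Let comb (A : set V) k x y :
  GRing.submod_closed [in A] -> A x -> A y -> A (k *: x + y).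
Proof. by move=> [_ /(_ k x y)]; rewrite !in_setE. Qed.

Let zero (A : set V) : GRing.submod_closed [in A] -> A 0.
Proof. by move=> [/set_mem]. Qed.

(** The graph of a linear functional that is dominated by [p] and defined on a
    subspace of [B]; encoding functionals as graphs makes the union of a chain
    immediate. *)
Definition dominated_graph (G : set (V * R)) :=
  [/\ forall k u v, G u -> G v -> G (k *: u.1 + v.1, k * u.2 + v.2) &
      forall u, G u -> B u.1 /\ u.2 <= p u.1].

Let p0 : p 0 = 0.
Proof.
have := pZ (ltr0n R 2) (zero subB); rewrite scaler0 => /eqP.
rewrite -subr_eq0 -{1}[p 0]mul1r -mulrBl mulf_eq0 => /orP[|/eqP//].
by rewrite (_ : 1 - 2 = -1 :> R) ?oppr_eq0 ?oner_eq0//; ring.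
Qed.

(** Domination alone forces uniqueness of the value: (0, a - b) belongs to the
    graph, and p 0 = 0 bounds both a - b and b - a by 0. *)
Lemma dominated_graph_functional G v a b :
  dominated_graph G -> G (v, a) -> G (v, b) -> a = b.
Proof.
move=> [Glin Gp].
wlog suff le_ab : a b / G (v, a) -> G (v, b) -> a <= b.
  by move=> Ga Gb; apply/le_anti; rewrite !le_ab.
move=> Ga Gb; have := Glin (-1) _ _ Gb Ga.
by rewrite scaleN1r addNr => /Gp[_] /=; rewrite p0 mulN1r addrC subr_le0.
Qed.

(** The value r assigned to [v] has to satisfy b - p(y - v) <= r and
    r <= p(x + v) - a for all (x, a), (y, b) in the graph, which the supremum of
    the left-hand sides does since a + b <= p(x + y) <= p(x + v) + p(y - v). *)
Lemma dominated_graph_extend G v : dominated_graph G -> G (0, 0) -> B v ->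
  exists r,
    dominated_graph [set (u.1 + k *: v, u.2 + k * r) | u in G & k in setT].
Proof.
move=> [Glin Gp] G0 Bv.
have GB u : G u -> B u.1 by move=> /Gp[].
have Bop k x : B x -> B (x + k *: v).
  by move=> Bx; rewrite addrC; exact: comb.
pose S := [set u.2 - p (u.1 + -1 *: v) | u in G].
have S_le u r : G u -> S r -> r <= p (u.1 + v) - u.2.
  move=> Gu [w Gw <-]; rewrite lerBlDr -addrA.
  have := Glin 1 _ _ Gw Gu; rewrite scale1r mul1r => /Gp[_ /= /le_trans le1].
  have Buv : B (u.1 + v) by rewrite -[v]scale1r; apply/Bop/GB.
  have Bwv : B (w.1 + -1 *: v) by apply/Bop/GB.
  have := le1 _ (_ : p (w.1 + u.1) <= p (w.1 + -1 *: v) + p (u.1 + v)).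
  suff -> : w.1 + u.1 = (w.1 + -1 *: v) + (u.1 + v).
    by move=> /(_ (pD Bwv Buv)); lra.
  by rewrite scaleN1r addrACA addNr addr0.
have S0 : S !=set0 by exists (0 - p (0 + -1 *: v)), (0, 0).
have S_ub : has_ubound S by exists (p (0 + v) - 0) => r /(S_le (0, 0) r G0).
exists (sup S); split.
  move=> k _ _ [u Gu [a _ <-]] [w Gw [b _ <-]] /=.
  exists (k *: u.1 + w.1, k * u.2 + w.2); first exact: Glin.
  exists (k * a + b) => //=; congr pair.
    by rewrite scalerDr scalerDl scalerA addrACA.
  by ring.
move=> _ [u Gu [k _ <-]] /=; split; first exact/Bop/GB.
(* scaling reduces the bound at u + k v to k = 1 and k = -1 *)
have Gsc c : G (c *: u.1, c * u.2).
  by have := Glin c _ _ Gu G0; rewrite /= !addr0.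
have scB c x : B x -> B (c *: x).
  by move=> Bx; have := comb c subB Bx (zero subB); rewrite addr0.
have [k0|k0|->] := ltgtP k 0; last first.
- by rewrite scale0r mul0r !addr0; have [] := Gp _ Gu.
- have -> : u.1 + k *: v = k *: (k^-1 *: u.1 + v).
    by rewrite scalerDr scalerA divff ?gt_eqF// scale1r.
  have -> : u.2 + k * sup S = k * (k^-1 * u.2 + sup S).
    by rewrite mulrDr mulrA divff ?gt_eqF// mul1r.
  rewrite pZ//; last by rewrite -[v]scale1r; apply/Bop/(GB _ (Gsc _)).
  rewrite ler_pM2l// -lerBrDl; apply: ge_sup => // r Sr.
  exact: (S_le _ _ (Gsc k^-1)).
- have k0' : 0 < - k by rewrite oppr_gt0.
  have -> : u.1 + k *: v = (- k) *: ((- k)^-1 *: u.1 + -1 *: v).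
    by rewrite scalerDr !scalerA divff ?gt_eqF// scale1r mulrN1 opprK.
  have -> : u.2 + k * sup S = (- k) * ((- k)^-1 * u.2 - sup S).
    by rewrite mulrBr mulrA divff ?gt_eqF// mul1r mulNr opprK.
  rewrite pZ//; last exact/Bop/(GB _ (Gsc _)).
  rewrite ler_pM2l// lerBlDr -lerBlDl; apply: ub_le_sup => //.
  by exists ((- k)^-1 *: u.1, (- k)^-1 * u.2).
Qed.

(** The majorant [p] is only required to be sublinear on the subspace [B], so
    that the essential supremum can be used although it is infinite on some
    unbounded functions. *)
Theorem hahn_banach : exists g : V -> R,
  [/\ forall x, F x -> g x = f x,
      forall k x y, B x -> B y -> g (k *: x + y) = k * g x + g y &
      forall x, B x -> g x <= p x].
Proof.
pose G0 : set (V * R) := [set (x, f x) | x in F].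
have f0 : f 0 = 0.
  have := f_lin 1 (zero subF) (zero subF).
  by rewrite scaler0 addr0 mul1r => /eqP; rewrite -subr_eq subrr => /eqP.
have G00 : G0 (0, 0) by exists 0; rewrite ?f0//; exact: zero.
have dG0 : dominated_graph G0.
  split=> [k _ _ [x Fx <-] [y Fy <-]|_ [x Fx <-]] /=.
    by exists (k *: x + y); rewrite ?f_lin//; exact: comb.
  by split; [exact: FB | exact: f_le].
(* the union with G0 makes the empty chain harmless *)
have [|A [dA maxA]] := @Zorn_bigcup _ [set A | dominated_graph (A `|` G0)].
  move=> C CP totC; split=> [k u v|u [[X CX Xu]|/dG0.2//]]; last first.
    by apply: (CP _ CX).2; left.
  move=> [[X CX Xu]|Gu] [[Y CY Yv]|Gv].
  - have [XY|YX] := totC _ _ CX CY.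
      have [|||] := (CP _ CY).1 k u v; [by left; exact: XY|by left| |by right].
      by left; exists Y.
    have [|||] := (CP _ CX).1 k u v; [by left|by left; exact: YX| |by right].
    by left; exists X.
  - have [|||] := (CP _ CX).1 k u v; [by left|by right| |by right].
    by left; exists X.
  - have [|||] := (CP _ CY).1 k u v; [by right|by left| |by right].
    by left; exists Y.
  - by right; exact: dG0.1.
set M := A `|` G0 in dA.
have M0 : M (0, 0) by right.
have totM v : B v -> exists a, M (v, a).
  move=> Bv; have [r dN] := dominated_graph_extend dA M0 Bv.
  set N := (X in dominated_graph X) in dN.
  have MN : M `<=` N.
    move=> [x a] Mxa; exists (x, a) => //; exists 0 => //=.
    by rewrite scale0r mul0r !addr0.
  exists r; apply: contrapT => nM.
  apply: (maxA N); last first.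
    by rewrite /= (_ : N `|` G0 = N)//; apply/setUidPl => x G0x; apply: MN; right.
  split=> [x Ax|NA]; first by apply: MN; left.
  apply: nM; left; apply: NA; exists (0, 0) => //.
  by exists 1 => //=; rewrite scale1r mul1r !add0r.
pose g v := xget 0 [set a | M (v, a)].
have Mg v : B v -> M (v, g v).
  by move=> /totM[a Ma]; rewrite /g; case: xgetP => //= /(_ a).
exists g; split=> [x Fx|k x y Bx By|x /Mg /dA.2[]//].
  by apply: (dominated_graph_functional dA (Mg _ (FB Fx))); right; exists x.
apply: (dominated_graph_functional dA (Mg _ (comb k subB Bx By))).
exact: (dA.1 k _ _ (Mg _ Bx) (Mg _ By)).
Qed.

End hahn_banach.

(** * Bounded measurable functions and finitely additive integrals *)

Section bounded_measurable.
Context d (T : measurableType d) (R : realType).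

Definition bounded_measurable : set (T -> R) :=
  [set f : T -> R | measurable_fun setT f /\ exists M : R, forall w, `|f w| <= M].

Lemma bounded_measurable_submod : GRing.submod_closed [in bounded_measurable].
Proof.
split=> [|k f g /set_mem[mf [M fM]] /set_mem[mg [N gN]]]; apply/mem_set.
  by split; [exact: measurable_cst | exists 0 => w; rewrite normr0].
split; first by apply: measurable_funD => //; exact: measurable_funM.
exists (`|k| * M + N) => w; apply: (le_trans (ler_normD _ _)).
by rewrite lerD// normrM ler_wpM2l.
Qed.

Lemma bounded_measurableD f g : bounded_measurable f -> bounded_measurable g ->
  bounded_measurable (f + g).
Proof.
have [_ H] := bounded_measurable_submod => Bf Bg.
by rewrite -[f]scale1r; apply/set_mem/H; exact/mem_set.
Qed.

Lemma bounded_measurableZ k f :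
  bounded_measurable f -> bounded_measurable (k *: f).
Proof.
have [H0 H] := bounded_measurable_submod => Bf.
by rewrite -[_ *: _]addr0; apply/set_mem/H => //; exact/mem_set.
Qed.

Lemma bounded_measurable_indic A : measurable A ->
  bounded_measurable (\1_A : T -> R).
Proof.
move=> mA; split; first exact: measurable_indic.
by exists 1 => w; rewrite indicE; case: (_ \in _); rewrite ?normr1 ?normr0.
Qed.

Lemma bounded_measurable_mfun (X : {mfun T >-> R}) :
  bounded_fun (X : T -> R) -> bounded_measurable X.
Proof.
move=> [M [_ XM]]; split=> //; exists (M + 1) => w.
by apply: (XM (M + 1)) => //; rewrite ltrDl.
Qed.

Lemma bounded_measurable_approx f : bounded_measurable f ->
  exists s : {sfun T >-> R}^nat, {uniform, (fun n => s n : T -> R) @ \oo --> f}.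
Proof.
move=> [mf [M fM]].
have fP : f \in mfun by rewrite inE.
apply: (sfun_uniform_approx (X := mfun_Sub fP)).
by exists M; split => [|N /ltW MN w _]; [exact: num_real|exact: le_trans (fM w) MN].
Qed.

End bounded_measurable.

Section contents.
Context d (T : measurableType d) (R : realType).

(** A content is nonnegative on every set, measurable or not, hence the default
    value 0 outside the sigma-algebra. *)
Lemma exists_content (m : set T -> R) :
  (forall A, measurable A -> 0 <= m A) ->
  (forall A B, measurable A -> measurable B -> A `&` B = set0 ->
    m (A `|` B) = m A + m B) ->
  exists P : {content set T -> \bar R},
    forall A, measurable A -> P A = (m A)%:E.
Proof.
move=> m0 mU.
pose f A : \bar R := if pselect (measurable A) then (m A)%:E else 0%:E.
have fE A : measurable A -> f A = (m A)%:E by rewrite /f; case: pselect.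
have f0 A : (0 <= f A)%E by rewrite /f; case: pselect => // mA; rewrite lee_fin m0.
have f00 : f set0 = 0%E.
  rewrite fE//; congr EFin; have := mU _ _ measurable0 measurable0 (setI0 _).
  by rewrite setU0; lra.
have fU : measure_function.semi_additive f.
  apply/(additive2P f00) => A B mA mB AB.
  by rewrite !fE ?mU//; exact: measurableU.
pose P : {content set T -> \bar R} := HB.pack f (isContent.Build _ _ _ f f0 fU).
by exists P.
Qed.

Variables (P : {content set T -> \bar R}).
Hypothesis P1 : P setT = 1%E.

Lemma fine_contentU A B : measurable A -> measurable B -> A `&` B = set0 ->
  fine (P (A `|` B)) = fine (P A) + fine (P B).
Proof.
move=> mA mB AB; apply: EFin_inj; rewrite EFinD -!(content_fineE P1)//.
  exact: measureU.
exact: measurableU.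
Qed.

Lemma sum_fine_content (s : {sfun T >-> R}) :
  \sum_(x <- finmap.enum_fset (fset_set (range s))) fine (P (s @^-1` [set x])) = 1.
Proof.
apply: EFin_inj; rewrite -sumEFin -P1.
under eq_bigr do rewrite -(content_fineE P1)//.
rewrite -fsbig_finite//= -content_fin_bigcup//=.
- by congr (P _); apply/seteqP; split => // x _; exists (s x).
- exact: trivIset_preimage1.
- exact: fin_bigcup_measurable.
Qed.

Lemma fa_expectation_fin_num f : bounded_measurable f ->
  fa_expectation P f \is a fin_num.
Proof.
move=> /bounded_measurable_approx[s sf].
have [l /(_ _ sf) sl] := sintegral_uniform_cvg P1 sf.
by rewrite (cvg_unique _ (cvg_fa_expectation P1 sf) sl).
Qed.

(** A functional that is linear, monotone and normalised (the second hypothesis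
    expresses both) is 1-Lipschitz for the uniform norm, and it agrees with the
    integral on simple functions by linearity. *)
Lemma fa_expectation_unique (phi : (T -> R) -> R) :
  (forall k f g, bounded_measurable f -> bounded_measurable g ->
    phi (k *: f + g) = k * phi f + phi g) ->
  (forall f e, bounded_measurable f -> (forall w, f w <= e) -> phi f <= e) ->
  (forall A, measurable A -> P A = (phi \1_A)%:E) ->
  forall f, bounded_measurable f -> fa_expectation P f = (phi f)%:E.
Proof.
move=> phi_lin phi_le phi1 f Bf.
have B0 : bounded_measurable (0 : T -> R).
  by have [/set_mem] := @bounded_measurable_submod _ T R.
have phi0 : phi 0 = 0.
  by have := phi_lin 1 0 0 B0 B0; rewrite scaler0 addr0; lra.
have phi_simple (s : {sfun T >-> R}) :
    bounded_measurable s /\ sintegral P s = (phi s)%:E.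
  set r := finmap.enum_fset (fset_set (range s)).
  rewrite (sintegral_contentE P1) -/r.
  pose A x := s @^-1` [set x]; pose g x : T -> R := \1_(A x).
  have mA x : measurable (A x) by exact: measurable_sfunP.
  have Bg x : bounded_measurable (g x) by exact: bounded_measurable_indic.
  have -> : \sum_(x <- r) x * fine (P (s @^-1` [set x])) =
      \sum_(x <- r) x * phi (g x).
    by apply: eq_bigr => x _; rewrite -/(A x) phi1.
  have -> : (s : T -> R) = \sum_(x <- r) x *: g x.
    apply/funext => w; rewrite fimfunE fsbig_finite//= fct_sumE.
    by apply: eq_bigr.
  elim: r => [|x r [BS IH]]; first by rewrite !big_nil phi0.
  rewrite !big_cons; split.
    by apply: bounded_measurableD => //; exact: bounded_measurableZ.
  case: IH => IH.
  by rewrite phi_lin// -IH.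
have [s sf] := bounded_measurable_approx Bf.
apply: (cvg_unique _ (cvg_fa_expectation P1 sf)).
  exact: ereal_hausdorff.
rewrite (_ : (fun n => _) = EFin \o (fun n => phi (s n))); last first.
  by apply/funext => n /=; rewrite (phi_simple _).2.
apply: cvg_EFin; first exact: nearW.
apply/cvgrPdist_le => e e0.
have := uniform_cvg_near e0 sf; apply: filterS => n sfn /=.
have [Bs _] := phi_simple (s n).
have phiB g h : bounded_measurable g -> bounded_measurable h ->
    phi g - phi h = phi (-1 *: h + g).
  by move=> Bg Bh; rewrite phi_lin//; lra.
rewrite ler_norml; apply/andP; split; last first.
  rewrite phiB//; apply: phi_le => [|w].
    by apply: bounded_measurableD => //; exact: bounded_measurableZ.
  have := sfn w; rewrite ltr_norml => /andP[_ /ltW].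
  by rewrite scaleN1r -[(_ + _) w]/(_ w + _ w) -[(- _) w]/(- (_ w)); lra.
rewrite -lerN2 opprK opprB phiB//; apply: phi_le => [|w].
  by apply: bounded_measurableD => //; exact: bounded_measurableZ.
have := sfn w; rewrite ltr_norml => /andP[/ltW + _].
by rewrite scaleN1r -[(_ + _) w]/(_ w + _ w) -[(- _) w]/(- (_ w)); lra.
Qed.

End contents.

(** * Expectations *)

Section expectations.
Context d (T : measurableType d) (R : realType).
Local Open Scope ereal_scope.

(** One sequence of simple functions approximates the integrals of [f] against
    the three contents at once, and on simple functions the identity is one
    between finite sums. *)
Lemma fa_expectation_mix (P P1 P2 : {content set T -> \bar R}) (a b : R) f :
  fa_probability P -> fa_probability P1 -> fa_probability P2 ->
  (forall A, measurable A -> P A = a%:E * P1 A + b%:E * P2 A) ->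
  bounded_measurable f ->
  fa_expectation P f = a%:E * fa_expectation P1 f + b%:E * fa_expectation P2 f.
Proof.
rewrite /fa_probability/= => P_1 P1_1 P2_1 PE Bf.
have [s sf] := bounded_measurable_approx Bf.
apply: (cvg_unique _ (cvg_fa_expectation P_1 sf)); first exact: ereal_hausdorff.
rewrite (_ : (fun n => _) = fun n =>
    a%:E * sintegral P1 (s n) + b%:E * sintegral P2 (s n)).
  apply: cvgeD; last 2 first.
  - by apply: cvgeZl => //; exact: cvg_fa_expectation.
  - by apply: cvgeZl => //; exact: cvg_fa_expectation.
  - by rewrite fin_num_adde_defr// fin_numM// fa_expectation_fin_num.
apply/funext => n; rewrite !sintegral_contentE// -!EFinM -EFinD; congr EFin.
rewrite !mulr_sumr -big_split/=; apply: eq_bigr => x _.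
have mx : measurable (s n @^-1` [set x]) by [].
have -> : fine (P (s n @^-1` [set x])) =
    (a * fine (P1 (s n @^-1` [set x])) + b * fine (P2 (s n @^-1` [set x])))%R.
  by apply: EFin_inj; rewrite EFinD !EFinM -!content_fineE// PE.
by ring.
Qed.

Lemma integrable_bounded_measurable (Q : probability T R) f :
  bounded_measurable f -> Q.-integrable setT (EFin \o f).
Proof.
move=> [mf [M fM]]; apply: measurable_bounded_integrable => //.
  by rewrite ltey_eq fin_num_measure.
by exists M; split => [|N /ltW MN w _]; [exact: num_real|exact: le_trans (fM w) MN].
Qed.

Lemma fa_expectation_Rintegral (Q : probability T R) f :
  bounded_measurable f -> fa_expectation Q f = (\int[Q]_x f x)%R%:E.
Proof.
apply: (fa_expectation_unique (@probability_setT _ _ _ Q)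
          (phi := fun f => (\int[Q]_x f x)%R)).
- move=> k g h Bg Bh; rewrite RintegralD ?RintegralZl//.
  + exact: integrable_bounded_measurable.
  + exact/integrable_bounded_measurable/bounded_measurableZ.
  + exact: integrable_bounded_measurable.
- move=> g e Bg ge; have -> : e = (\int[Q]_(x in setT) cst e x)%R.
    by rewrite Rintegral_cst// [X in fine X](probability_setT Q) mulr1.
  apply: le_Rintegral => //; first exact: integrable_bounded_measurable.
  by apply: integrable_bounded_measurable; split => //; exists `|e|%R.
- move=> A mA; rewrite /Rintegral integral_indic// setIT fineK//.
  exact: fin_num_measure.
Qed.

(** Linearity is inherited from the Lebesgue integral, which is why [Q] is
    countably additive here. *)
Lemma fa_expectation_linear (Q : probability T R) (k : R) f g :
  bounded_measurable f -> bounded_measurable g ->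
  fa_expectation Q (k *: f + g)%R =
  k%:E * fa_expectation Q f + fa_expectation Q g.
Proof.
move=> Bf Bg; have Bkf := bounded_measurableZ k Bf.
rewrite !fa_expectation_Rintegral//; last exact: bounded_measurableD.
rewrite -EFinM -EFinD; congr EFin.
by rewrite RintegralD ?RintegralZl//; exact: integrable_bounded_measurable.
Qed.

Lemma fa_expectationN (Q : probability T R) f : bounded_measurable f ->
  fa_expectation Q (- f)%R = - fa_expectation Q f.
Proof.
move=> Bf; rewrite !fa_expectation_Rintegral//; last first.
  by rewrite -scaleN1r; exact: bounded_measurableZ.
rewrite -EFinN; congr EFin; rewrite -[RHS]mulN1r -RintegralZl//.
  by apply: eq_Rintegral => w _; rewrite mulN1r.
exact: integrable_bounded_measurable.
Qed.

(** The set where [f] exceeds its essential supremum S is [P0]-null, hence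
    [P]-null; a simple function e-close to [f] therefore takes its values above
    S + e on [P]-null sets. *)
Lemma fa_expectation_le_ess_sup (P0 : probability T R)
    (P : {content set T -> \bar R}) f :
  fa_probability P -> content_dominates P0 P -> bounded_measurable f ->
  fa_expectation P f <= ess_sup P0 (fun w => (f w)%:E).
Proof.
rewrite /fa_probability/= => P1 PP0 Bf; have [mf _] := Bf.
have [mS S_ge] : measurable [set w | ess_sup P0 (fun w => (f w)%:E) < (f w)%:E] /\
    P0 [set w | ess_sup P0 (fun w => (f w)%:E) < (f w)%:E] = 0.
  have mEf : measurable_fun setT (EFin \o f) by exact/measurable_EFinP.
  set S := ess_sup _ _.
  have -> : [set w | S < (f w)%:E] = (EFin \o f) @^-1` `]S, +oo[.
    by apply/seteqP; split=> w /=; rewrite in_itv/= andbT.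
  split; first by rewrite -[_ @^-1` _]setTI; apply/mEf => //; exact: emeasurable_itv.
  by apply/(ae_le_measureP P0 _ mEf); exact: ess_sup_ge.
set S := ess_sup _ _ in mS S_ge *.
have [s sf] := bounded_measurable_approx Bf.
have [->|SNy] := eqVneq S +oo; first by rewrite leey.
have SNNy : S != -oo.
  apply/eqP => SE; move: S_ge; rewrite SE (_ : [set w | _] = setT).
    by rewrite probability_setT => /eqP; rewrite onee_eq0.
  by apply/seteqP; split => // w _ /=; rewrite ltNyr.
have [r Sr] : exists r, S = r%:E by case: S SNy SNNy {mS S_ge} => // r; exists r.
rewrite {}Sr in mS S_ge *; apply/lee_addgt0Pr => e e0; rewrite -EFinD.
rewrite -(cvg_lim _ (cvg_fa_expectation P1 sf)); last exact: ereal_hausdorff.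
apply: lime_le; first by apply/cvg_ex; eexists; exact: cvg_fa_expectation sf.
have := uniform_cvg_near e0 sf; apply: filterS => n sfn.
rewrite (sintegral_contentE P1) lee_fin.
rewrite -[leRHS]mulr1 -(sum_fine_content P1 (s n)) mulr_sumr.
apply: ler_sum => x _.
have [xe|xe] := leP x (r + e)%R; first by rewrite ler_wpM2r// fine_ge0.
suff -> : P (s n @^-1` [set x]) = 0 by rewrite !mulr0.
apply: PP0 => //; apply: (subset_measure0 _ mS _ S_ge) => // w /= swx.
have := sfn w; rewrite swx ltr_norml lte_fin; lra.
Qed.


End expectations.

(** * The largest sigma-additive part of a content *)

Section sigma_additive_part.
Context d (T : measurableType d) (R : realType) (P : {content set T -> \bar R}).
Local Open Scope ereal_scope.

(** Splitting each set of a cover along [A] only uses finite additivity of [P],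
    so measurable sets are Caratheodory measurable even if [P] is not a
    measure. *)
Lemma mu_ext_content_caratheodory A :
  measurable A -> (P^*%mu).-caratheodory A.
Proof.
move=> mA; apply: le_caratheodory_measurable => X.
apply: le_ereal_inf_tmp => _ [F [mF XF] <-].
rewrite (@eq_eseriesr _ _ (fun k => P (F k `&` A) + P (F k `&` ~` A))).
  rewrite nneseriesD//; apply: leeD; apply: ereal_inf_lbound.
  - exists (fun k => F k `&` A) => //; split; first by move=> k; exact: measurableI.
    by rewrite -setI_bigcupl; exact: setSI.
  - exists (fun k => F k `&` ~` A) => //; split.
      by move=> k; apply: measurableI => //; exact: measurableC.
    by rewrite -setI_bigcupl; exact: setSI.
by move=> k _; rewrite (measureDI P (mF k) mA) setDE addeC.
Qed.

Lemma mu_ext_content_le A : measurable A -> P^*%mu A <= P A.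
Proof.
move=> mA; apply: ereal_inf_lbound; exists (fun k => if k is 0%N then A else set0).
  by split=> [[]//|w Aw]; exists 0%N.
rewrite nneseries_recl// eseries0 ?adde0//.
by case=> // k _ _; rewrite measure0.
Qed.

(** A measure below [P] is countably subadditive, so it is bounded by the
    [P]-mass of any cover. *)
Lemma mu_ext_content_max (G : {measure set T -> \bar R}) :
  (forall A, measurable A -> G A <= P A) ->
  forall A, measurable A -> G A <= P^*%mu A.
Proof.
move=> GP A mA; apply: le_ereal_inf_tmp => _ [F [mF AF] <-].
apply: (le_trans (measure_sigma_subadditive G mF mA AF)).
by apply: lee_nneseries => // n _; exact: GP.
Qed.

Lemma exists_sigma_additive_part : exists G : {measure set T -> \bar R},
  [/\ forall A, measurable A -> G A = P^*%mu A,
      forall A, measurable A -> G A <= P A &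
      forall H : {measure set T -> \bar R},
        (forall A, measurable A -> H A <= P A) ->
        forall A, measurable A -> H A <= G A].
Proof.
pose f : set T -> \bar R := P^*%mu.
have f0 : f set0 = 0 by exact: outer_measure0.
have f_ge0 A : 0 <= f A by exact: outer_measure_ge0.
have fU : semi_sigma_additive f.
  move=> F mF tF mUF; apply: caratheodory_measure_sigma_additive => //.
    by move=> i; exact: mu_ext_content_caratheodory.
  exact: mu_ext_content_caratheodory.
pose G : {measure set T -> \bar R} := HB.pack f (isMeasure.Build _ _ _ f f0 f_ge0 fU).
exists G; split=> //; [exact: mu_ext_content_le | exact: mu_ext_content_max].
Qed.

Variable P0 : probability T R.
Hypothesis P0P : forall A, measurable A -> P A = 0 -> P0 A = 0.

(** [C] is a finite subfamily of a countable cover of [A] of small [P]-mass;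
    continuity from above of [P0] makes the uncovered part small. *)
Lemma mu_ext_content0_cover A (a b : R) : measurable A -> P^*%mu A = 0 ->
  (0 < a)%R -> (0 < b)%R ->
  exists C, [/\ measurable C, P C <= a%:E & P0 (A `\` C) <= b%:E].
Proof.
move=> mA A0 a0 b0.
have [|_ [F [mF AF] <-] Fa] := lb_ereal_inf_adherent a0 (_ : P^*%mu A \is a fin_num).
  by rewrite A0.
rewrite -/(P^*%mu A) A0 add0e in Fa.
pose C n := \big[setU/set0]_(k < n) F k.
have mC n : measurable (C n) by exact: bigsetU_measurable.
have PC n : P (C n) <= a%:E.
  apply: (le_trans (Boole_inequality _ _)) => [i _//|].
  apply/(le_trans _ (ltW Fa)); rewrite -(big_mkord xpredT (fun i => P (F i))).
  exact: nneseries_lim_ge.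
have AC0 : \bigcap_n (A `\` C n) = set0.
  rewrite -subset0 => w Aw; have [Aw0 _] := Aw 0%N I.
  have [n _ Fw] := AF _ Aw0; have [_] := Aw n.+1 I; apply.
  by rewrite /C big_ord_recr; right.
have : P0 \o (fun n => A `\` C n) @ \oo --> P0 (\bigcap_n (A `\` C n)).
  apply: nonincreasing_cvg_mu => //.
  - by rewrite ltey_eq fin_num_measure//; exact: measurableD.
  - by move=> n; exact: measurableD.
  - by rewrite AC0.
  - move=> m n mn; apply/subsetPset; apply: setDS => w.
    rewrite /C -!bigcup_mkord => -[k /= km Fw]; exists k => //=.
    exact: leq_trans km mn.
rewrite AC0 measure0 => /fine_cvgP[_ /cvgrPdist_le/(_ _ b0)] [N _ /(_ N (leqnn _))].
rewrite /= sub0r normrN ger0_norm ?fine_ge0// => PN.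
exists (C N); split=> //; rewrite -lee_fin fineK// in PN.
by rewrite fin_num_measure//; exact: measurableD.
Qed.

(** The intersection of sets [C k] as above, with P(C k) <= 1 / (k + 1) and
    P0(A \ C k) <= e / 2^(k + 1), is [P]-null, hence [P0]-null, and it misses at
    most [P0]-mass e of [A]. *)
Lemma mu_ext_content0_null A : measurable A -> P^*%mu A = 0 -> P0 A = 0.
Proof.
move=> mA A0; apply/eqP; rewrite -measure_le0; apply/lee_addgt0Pr => e e0.
rewrite add0e.
have /choice[C CP] : forall k, exists C, [/\ measurable C, P C <= (k.+1%:R^-1)%:E &
    P0 (A `\` C) <= (e / (2 ^ k.+1)%:R)%:E].
  by move=> k; apply: mu_ext_content0_cover => //; rewrite divr_gt0// ltr0n expn_gt0.
have mC k : measurable (C k) by have [] := CP k.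
pose B := A `&` \bigcap_k C k.
have mB : measurable B by apply: measurableI => //; exact: bigcapT_measurable.
have PB : P B = 0.
  apply/eqP; rewrite -measure_le0; apply/lee_addgt0Pr => c c0; rewrite add0e.
  have [k _ /(_ k (leqnn _)) kc] := near_infty_natSinv_lt (PosNum c0).
  apply: (@le_trans _ _ (k.+1%:R^-1)%:E); last by rewrite lee_fin ltW.
  have [_ + _] := CP k; apply: le_trans; apply: le_measure; rewrite ?inE//.
  by move=> w [_]; exact.
rewrite -[e%:E]add0e -(P0P mB PB).
rewrite (measureDI P0 mA (bigcapT_measurable mC)) [leRHS]addeC leeD2r//.
have -> : A `\` \bigcap_k C k = \bigcup_k (A `\` C k).
  by rewrite setDE setC_bigcap setI_bigcupr.
have mAC k : measurable (A `\` C k) by exact: measurableD.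
apply: (le_trans (generalized_Boole_inequality P0 mAC (bigcupT_measurable _ mAC))).
apply: (le_trans _ (epsilon_trick0 xpredT (ltW e0))).
by apply: lee_nneseries => // k _; have [] := CP k.
Qed.

End sigma_additive_part.

(** * Decomposition into a pure part and an equivalent probability *)

Section yosida_hewitt.
Context d (T : measurableType d) (R : realType).
Variables (P0 : probability T R) (P : {content set T -> \bar R}).
Hypothesis P1 : fa_probability P.
Hypothesis PP0 : same_null_sets P P0.
Local Open Scope ereal_scope.

(** [Q] is the normalisation of the largest measure G below [P], and [P1] that
    of P - G: a measure H below [P1] would make alpha H + G a measure below [P],
    hence below G, so H = 0. *)
Theorem yosida_hewitt :
  exists (alpha : R) (P1 : {content set T -> \bar R}) (Q : probability T R),
    [/\ (0 <= alpha < 1)%R, fa_probability P1, (alpha != 0%R -> pure P1),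
        same_null_sets Q P0 &
        forall A, measurable A -> P A = alpha%:E * P1 A + (1 - alpha)%:E * Q A].
Proof.
have [G [GE GP Gmax]] := exists_sigma_additive_part P.
pose p A := fine (P A); pose g A := fine (G A).
have pE A : measurable A -> P A = (p A)%:E by exact: content_fineE.
have gE A : measurable A -> G A = (g A)%:E.
  move=> mA; rewrite fineK// ge0_fin_numE//.
  by rewrite (le_lt_trans (GP _ mA))// pE// ltry.
have gp A : measurable A -> (g A <= p A)%R.
  by move=> mA; rewrite -lee_fin -gE// -pE// GP.
have g_ge0 A : (0 <= g A)%R by exact: fine_ge0.
have pT : p setT = 1%R by apply: EFin_inj; rewrite -pE.
have GP0 : same_null_sets G P0.
  move=> A mA; split=> [GA|PA].
    apply: (mu_ext_content0_null (P := P)) => //; last by rewrite -GE.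
    by move=> B mB; exact: (PP0 mB).1.
  by apply/eqP; rewrite -measure_le0 -(PP0 mA).2// GP.
have gT0 : (0 < g setT)%R.
  rewrite lt_def g_ge0 andbT; apply/eqP => gT.
  have /eqP : P0 setT = 0 by apply/(GP0 _ measurableT).1; rewrite gE// gT.
  by rewrite [X in X == _](probability_setT P0) onee_eq0.
have QE : mnormalize G P0 = fun A => G A * (g setT)^-1%:E.
  by rewrite /mnormalize gE// eqe gt_eqF.
pose Q : probability T R := mnormalize G P0.
have gQ A : measurable A -> (1 - (1 - g setT))%:E * Q A = (g A)%:E.
  move=> mA; rewrite /Q/= QE gE// -!EFinM; congr EFin.
  by rewrite subKr mulrC divfK// gt_eqF.
have QP0 : same_null_sets Q P0.
  move=> A mA; rewrite -GP0// /Q/= QE; split=> [/eqP|->]; last by rewrite mul0e.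
  by rewrite gE// -EFinM !eqe mulf_eq0 invr_eq0 (gt_eqF gT0) orbF => /eqP ->.
have pU A B : measurable A -> measurable B -> A `&` B = set0 ->
    p (A `|` B) = (p A + p B)%R by exact: fine_contentU.
have gU A B : measurable A -> measurable B -> A `&` B = set0 ->
    g (A `|` B) = (g A + g B)%R.
  move=> mA mB AB; apply: EFin_inj; rewrite EFinD -!gE//; first exact: measureU.
  exact: measurableU.
have gT1 : (g setT <= 1)%R by rewrite -pT gp.
have alpha01 : (0 <= 1 - g setT < 1)%R by rewrite subr_ge0 gT1 ltrBlDr ltrDl.
(* if G has full mass then G = P, as G <= P also holds on complements *)
have [a0|a0] := eqVneq (1 - g setT)%R 0%R.
  exists (1 - g setT)%R, P, Q; split => //; first by rewrite a0 eqxx.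
  move=> A mA; rewrite gQ// a0 mul0e add0e pE//; congr EFin.
  have mCA := measurableC mA.
  have := gU _ _ mA mCA (setICr _); have := pU _ _ mA mCA (setICr _).
  have := gp _ mA; have := gp _ mCA; rewrite setUv; lra.
have a_gt0 : (0 < 1 - g setT)%R by rewrite lt_def a0; case/andP: alpha01.
have [||P' P'E] := @exists_content _ _ _ (fun A => (p A - g A) / (1 - g setT))%R.
- by move=> A mA; rewrite divr_ge0// ?subr_ge0 ?gp// ltW.
- by move=> A B mA mB AB; rewrite pU// gU//; field.
exists (1 - g setT)%R, P', Q; split => //.
- by rewrite /fa_probability/= P'E// pT divff.
- move=> _ H HP' A mA.
  pose a : {nonneg R} := NngNum (ltW a_gt0).
  pose K : {measure set T -> \bar R} := measure_add (mscale a H) G.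
  have KE B : K B = (1 - g setT)%:E * H B + G B by rewrite [LHS]measure_addE.
  have KP B : measurable B -> K B <= P B.
    move=> mB; rewrite KE gE// pE//.
    have : (1 - g setT)%:E * H B <= (1 - g setT)%:E * P' B.
      by rewrite lee_wpmul2l// ?HP'// lee_fin ltW.
    rewrite P'E// -EFinM mulrC divfK// => /(leeD2r (g B)%:E) /le_trans; apply.
    by rewrite -EFinD subrK.
  have := Gmax K KP A mA; rewrite KE -[leRHS]add0e gE// leeD2rE//.
  rewrite pmule_rle0 ?lte_fin// measure_le0 => /eqP//.
- move=> A mA; rewrite gQ// P'E// -EFinM -EFinD pE//; congr EFin.
  by rewrite mulrC divfK// subrK.
Qed.

End yosida_hewitt.

(** * Functionals dominated by the essential supremum *)

Section extension.
Context d (T : measurableType d) (R : realType) (P0 : probability T R).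

Let esup (f : T -> R) : R := fine (ess_sup P0 (fun w => (f w)%:E)).

Let P0T : (0 < P0 setT)%E.
Proof. by rewrite [X in (_ < X)%E](probability_setT P0) lte01. Qed.

Lemma ess_sup_fin_num f : bounded_measurable f ->
  ess_sup P0 (fun w => (f w)%:E) \is a fin_num.
Proof.
move=> [_ [M fM]]; rewrite fin_numE; apply/andP; split.
  rewrite gt_eqF// (@lt_le_trans _ _ (- M)%:E) ?ltNyr//.
  apply: ess_sup_ger => // w; rewrite lee_fin.
  by have := fM w; rewrite ler_norml => /andP[].
rewrite lt_eqF// (@le_lt_trans _ _ M%:E) ?ltry//.
apply: ess_sup_ler => // w; rewrite lee_fin.
by have := fM w; rewrite ler_norml => /andP[].
Qed.

Let esupE f : bounded_measurable f ->
  ess_sup P0 (fun w => (f w)%:E) = (esup f)%:E.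
Proof. by move=> Bf; rewrite fineK// ess_sup_fin_num. Qed.

(** A Hahn-Banach extension phi of [f] satisfies phi(x) <= ess sup x. Applied to
    x and -x this makes phi positive and normalised, and zero on the indicators
    of [P0]-null sets. *)
Lemma exists_fa_probability_extension (F : set (T -> R)) (f : (T -> R) -> R) :
  GRing.submod_closed [in F] -> F `<=` @bounded_measurable _ T R ->
  (forall k x y, F x -> F y -> f (k *: x + y) = k * f x + f y) ->
  (forall x, F x -> ((f x)%:E <= ess_sup P0 (fun w => (x w)%:E))%E) ->
  exists P : {content set T -> \bar R},
    [/\ fa_probability P, content_dominates P0 P &
        forall x, F x -> fa_expectation P x = (f x)%:E].
Proof.
move=> subF FB f_lin f_le.
have [|||x Fx|phi [phiF phi_lin phi_le]] := @hahn_banach _ _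
    (@bounded_measurable _ T R) F esup f
    (@bounded_measurable_submod _ T R) subF FB.
- move=> x y Bx By; rewrite -lee_fin EFinD -!esupE//; last exact: bounded_measurableD.
  exact: ess_suprD.
- move=> k x k0 Bx; apply: EFin_inj; rewrite EFinM -!esupE//; last first.
    exact: bounded_measurableZ.
  by rewrite -ess_suprZl// ltW.
- exact: f_lin.
- by rewrite -lee_fin -esupE ?f_le//; exact: FB.
have B_ae x (e : R) : bounded_measurable x ->
    (\forall w \ae P0, x w <= e) -> phi x <= e.
  move=> Bx xe; apply: (le_trans (phi_le _ Bx)); rewrite -lee_fin -esupE//.
  by apply/ess_supP; apply: filterS xe => w; rewrite lee_fin.
have B0 : bounded_measurable (0 : T -> R).
  by have [/set_mem] := @bounded_measurable_submod _ T R.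
have phiN x : bounded_measurable x -> phi (- x) = - phi x.
  move=> Bx; have := phi_lin (-1) x 0 Bx B0; have := phi_lin 1 0 0 B0 B0.
  by rewrite scaler0 !addr0 scaleN1r; lra.
have phi_ge x (e : R) : bounded_measurable x ->
    (\forall w \ae P0, e <= x w) -> e <= phi x.
  move=> Bx xe; rewrite -lerN2 -phiN//; apply: B_ae.
    by rewrite -scaleN1r; exact: bounded_measurableZ.
  by apply: filterS xe => w; rewrite -[(- x) w]/(- (x w)) lerN2.
have B1 A : measurable A -> bounded_measurable (\1_A : T -> R).
  exact: bounded_measurable_indic.
have [||P PE] := @exists_content _ T R (fun A => phi \1_A).
- move=> A mA; apply: phi_ge; first exact: B1.
  by apply: nearW => w; rewrite indicE.
- move=> A B mA mB AB; rewrite -[phi \1_A]mul1r -phi_lin ?scale1r//; last 2 first.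
    exact: B1.
    exact: B1.
  congr phi; apply/funext => w; rewrite -[RHS]/(\1_A w + \1_B w) !indicE in_setU.
  have [wA|_] := boolP (w \in A); last by rewrite add0r.
  have [wB|_] := boolP (w \in B); last by rewrite addr0.
  suff : set0 w by []; rewrite -AB; split; exact: set_mem.
have P1 : P setT = 1%E.
  rewrite PE//; congr EFin; apply/eqP; rewrite eq_le B_ae ?phi_ge//; try exact: B1.
    by apply: nearW => w; rewrite indicE in_setT.
  by apply: nearW => w; rewrite indicE in_setT.
exists P; split=> //.
- move=> A mA PA; rewrite PE//; congr EFin; apply/eqP.
  rewrite eq_le B_ae ?phi_ge//; try exact: B1.
    by apply: nearW => w; rewrite indicE.
  exists A; split => // w /= /negP; rewrite -ltNge indicE.
  by case: (boolP (w \in A)) => [/set_mem//|]; rewrite ltxx.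
- move=> x Fx; rewrite -phiF//.
  apply: (fa_expectation_unique P1) => //; last exact: FB.
  by move=> y e By ye; apply: B_ae => //; exact: nearW.
Qed.

End extension.

(** * Finitely additive probabilities with zero expectation on L *)

Local Open Scope ereal_scope.

Theorem theorem3 (R : realType) (d : measure_display) (T : measurableType d)
    (P0 : probability T R) (L : set {RV P0 >-> R})
    (linL : GRing.submod_closed [in L])
    (bndL : forall X : {RV P0 >-> R}, L X -> bounded_fun (X : T -> R)) :
  [/\
    (exists P : {content set T -> \bar R},
        [/\ fa_probability P,
            content_dominates P0 P &
            forall X : {RV P0 >-> R}, L X -> fa_expectation P X = 0]) <->
    (forall X : {RV P0 >-> R}, L X -> 0 <= ess_sup P0 (fun w => (X w)%:E)),

    (exists P : {content set T -> \bar R},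
        [/\ fa_probability P,
            same_null_sets P P0 &
            forall X : {RV P0 >-> R}, L X -> fa_expectation P X = 0]) <->
    (exists (Q : probability T R) (c : R),
        [/\ same_null_sets Q P0,
            (0 < c)%R &
            forall X : {RV P0 >-> R}, L X ->
              c%:E * fa_expectation Q X <= ess_sup P0 (fun w => (- X w)%:E)]) &

    forall P : {content set T -> \bar R},
      fa_probability P ->
      same_null_sets P P0 ->
      (forall X : {RV P0 >-> R}, L X -> fa_expectation P X = 0) ->
      exists (alpha : R) (P1 : {content set T -> \bar R})
             (Q : probability T R),
        [/\ (0 <= alpha < 1)%R,
            fa_probability P1,
            (alpha != 0%R -> pure P1),
            same_null_sets Q P0 &
            forall A : set T, measurable A ->
              P A = alpha%:E * P1 A + (1 - alpha)%:E * Q A]].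
Proof.
have Bmfun (X : {RV P0 >-> R}) : L X -> bounded_measurable (X : T -> R).
  by move=> LX; apply: bounded_measurable_mfun; exact: bndL.
pose F : set (T -> R) := [set (X : T -> R) | X in L].
have subF : GRing.submod_closed [in F].
  have [/set_mem L0 Llin] := linL; split; first by apply/mem_set; exists 0%R.
  move=> k _ _ /set_mem[X LX <-] /set_mem[Y LY <-]; apply/mem_set.
  by exists (k *: X + Y)%R => //; apply/set_mem/Llin; exact/mem_set.
have FB : F `<=` @bounded_measurable _ T R by move=> _ [X LX <-]; exact: Bmfun.
have LN (X : {RV P0 >-> R}) : L X -> F (- (X : T -> R))%R.
  have [/set_mem L0 Llin] := linL => LX; exists ((-1) *: X + 0)%R.
    by apply/set_mem/Llin; exact/mem_set.
  apply/funext => w; rewrite -[LHS]/(-1 * X w + 0)%R -[RHS]/(- X w)%R.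
  by rewrite mulN1r addr0.
split.
- split=> [[P [P1 PP0 PL]] X LX|Lge].
    by rewrite -(PL X LX); apply: fa_expectation_le_ess_sup => //; exact: Bmfun.
  have [||P [P1 PP0 PF]] := @exists_fa_probability_extension _ _ _ P0 F
      (fun=> 0%R) subF FB.
  + by move=> k x y _ _; rewrite mulr0 addr0.
  + by move=> _ [X LX <-]; exact: Lge.
  by exists P; split => // X LX; rewrite PF//; exists X.
- split=> [[P [P1 PP0 PL]]|[Q [c [QP0 c0 QL]]]].
    have [alpha [P' [Q [/andP[a0 a1] P'1 _ QP0 PE]]]] := yosida_hewitt P1 PP0.
    have PN X : L X -> fa_expectation P (- (X : T -> R))%R = 0.
      by move=> /LN[Y LY <-]; exact: PL.
    have BN X : L X -> bounded_measurable (- (X : T -> R))%R.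
      by move=> /LN/FB.
    have Emix X : L X -> (alpha%:E * fa_expectation P' (- (X : T -> R))%R =
        (1 - alpha)%:E * fa_expectation Q X).
      move=> LX; have := PN X LX.
      rewrite (fa_expectation_mix P1 P'1 (@probability_setT _ _ _ Q) PE (BN _ LX)).
      rewrite (fa_expectationN Q (Bmfun _ LX)).
      rewrite -(fineK (fa_expectation_fin_num P'1 (BN _ LX))).
      rewrite -(fineK (fa_expectation_fin_num (@probability_setT _ _ _ Q) (Bmfun _ LX))).
      by rewrite -EFinN -!EFinM -EFinD => -[h]; congr EFin; lra.
    (* if alpha = 0, nothing ties P' to P0; but then E_Q = E_P vanishes on L *)
    have [aE|a_neq0] := eqVneq alpha 0%R.
      exists Q, 1%R; split => // X LX.
      have := Emix X LX; rewrite aE mul0e subr0 => <-.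
      rewrite -(PN X LX); apply: fa_expectation_le_ess_sup => //; last exact: BN.
      by move=> A mA /(PP0 A mA).2.
    have {}a0 : (0 < alpha)%R by rewrite lt_def a_neq0.
    exists Q, ((1 - alpha) / alpha)%R; split => //.
      by rewrite divr_gt0// subr_gt0.
    move=> X LX.
    rewrite mulrC EFinM -muleA -Emix// muleA -EFinM mulVf// mul1e.
    apply: fa_expectation_le_ess_sup => //; last exact: BN.
    move=> A mA PA; have := (PP0 A mA).2 PA.
    rewrite PE// (QP0 A mA).2// mule0 adde0 => /eqP.
    by rewrite mule_eq0 eqe gt_eqF//= => /eqP.
  pose f (x : T -> R) := (- c * fine (fa_expectation Q x))%R.
  have Q1 : fa_probability Q by exact: probability_setT.
  have EQ_fin x : F x -> fa_expectation Q x \is a fin_num.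
    by move=> Fx; apply: fa_expectation_fin_num => //; exact: FB.
  have [||P' [P'1 P'P0 P'F]] := @exists_fa_probability_extension _ _ _ P0 F f subF FB.
  + move=> k x y Fx Fy; rewrite /f fa_expectation_linear; [|exact: FB..].
    by rewrite fineD ?fin_numM ?EQ_fin// fineM ?EQ_fin//=; ring.
  + move=> x Fx; have [X LX XE] := Fx; have [Y LY YE] := LN _ LX.
    rewrite /f EFinM fineK ?EQ_fin// EFinN mulNe -muleN -XE.
    rewrite -(fa_expectationN Q (Bmfun _ LX)) -YE.
    apply: (le_trans (QL _ LY)); apply: le_ess_sup; apply: nearW => w.
    by rewrite YE -[(- _)%R w]/(- (X w))%R opprK.
  pose p A := ((1 + c)^-1 * fine (P' A) + (c / (1 + c)) * fine (Q A))%R.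
  have c1 : (0 < 1 + c)%R by rewrite addr_gt0.
  have [||P PE] := @exists_content _ T R p.
  + by move=> A _; rewrite addr_ge0// mulr_ge0 ?fine_ge0// ?invr_ge0 ?divr_ge0// ltW.
  + by move=> A B mA mB AB; rewrite /p !fine_contentU//; ring.
  have {}PE A : measurable A ->
      P A = (1 + c)^-1%:E * P' A + (c / (1 + c))%:E * Q A.
    by move=> mA; rewrite PE// /p EFinD !EFinM -!content_fineE.
  have P1 : fa_probability P.
    rewrite /fa_probability/= PE// [P' _]P'1 [X in _ + _ * X]Q1 !mule1 -EFinD.
    by congr EFin; field; rewrite gt_eqF.
  exists P; split => //.
  + move=> A mA; rewrite PE//; split=> [/eqP|P0A].
      rewrite padde_eq0 ?mule_ge0 ?lee_fin ?invr_ge0 ?divr_ge0 ?(ltW c1) ?(ltW c0)//.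
      move=> /andP[_]; rewrite mule_eq0 eqe gt_eqF ?divr_gt0//= => /eqP QA.
      exact: (QP0 A mA).1.
    by rewrite P'P0// (QP0 A mA).2// !mule0 adde0.
  + move=> X LX; have FX : F X by exists X.
    rewrite (fa_expectation_mix P1 P'1 Q1 PE (FB _ FX)) P'F// /f.
    rewrite -(fineK (EQ_fin _ FX)) -!EFinM -EFinD; congr EFin => /=.
    by field; rewrite gt_eqF.
- by move=> P P1 PP0 _; exact: yosida_hewitt.
Qed.
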